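(* Let $\kappa$ be an infinite regular cardinal and let $\varphi$ be a linear order type of size $\kappa$. Then for all $n<\omega$ and all $\kappa$-saturated linear order types $\tau$, $\tau \longrightarrow (\varphi, n)^2$.
   Context: A linear order $P$ (and its order type) is $\kappa$-saturated if $P\neq\emptyset$ and, for all $A,B\subseteq P$ (one or both possibly empty) with $|A|,|B|<\kappa$ and $A<_P B$ (i.e. $a<_P b$ for all $a\in A$, $b\in B$), there is $c\in P$ with $A<_P c<_P B$. The size of an order type is the cardinality of any order of that type. For linear order types $\tau,\varphi$ and $n<\omega$, $\tau\longrightarrow(\varphi,n)^2$ means: whenever $P$ is a linear order of type $\tau$ and $f:[P]^2\to\{0,1\}$ (where $[P]^2$ is the set of two-element subsets of $P$), either there is a suborder $Q\subseteq P$ of type $\varphi$ with $f$ constantly $0$ on $[Q]^2$, or there is $Q\subseteq P$ with $n$ elements with $f$ constantly $1$ on $[Q]^2$. *)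

(* Defs.v *)
From mathcomp Require Import all_boot all_order.
From mathcomp Require Import boolp classical_sets functions cardinality.
From mathcomp Require wochoice.

Set Implicit Arguments.
Unset Strict Implicit.
Unset Printing Implicit Defensive.

Import Order.TTheory.

Local Open Scope classical_set_scope.
Local Open Scope card_scope.
Local Open Scope order_scope.

Definition card_lt T U (A : set T) (B : set U) : Prop :=
  A #<= B /\ ~ (B #<= A).

(* A cardinal is represented by an initial ordinal: a well-order whose proper
   initial segments all have strictly smaller cardinality. *)
Definition initial_ordinal d (K : orderType d) : Prop :=
  wochoice.well_order (<=%O : rel K) /\
  forall x : K, card_lt [set y : K | y < x] [set: K].

Definition cofinal d (K : orderType d) (X : set K) : Prop :=
  forall x, exists2 y, X y & x <= y.

(* cf(K) = |K|: the whole of K is cofinal, so the least cardinality of a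
   cofinal subset is |K| iff no cofinal subset is smaller. *)
Definition infinite_regular_cardinal d (K : orderType d) : Prop :=
  [/\ initial_ordinal K,
      infinite_set [set: K] &
      forall X : set K, cofinal X -> [set: K] #<= X].

Definition set_lt d (P : orderType d) (A B : set P) : Prop :=
  forall a b, A a -> B b -> a < b.

Definition saturated (K : Type) d (P : orderType d) : Prop :=
  [set: P] !=set0 /\
  forall A B : set P,
    card_lt A [set: K] -> card_lt B [set: K] -> set_lt A B ->
    exists c : P, set_lt A [set c] /\ set_lt [set c] B.

(* The suborder Q of P is isomorphic to F.  Order types are represented
   throughout by a linear order of that type. *)
Definition has_type d d' (P : orderType d) (Q : set P) (F : orderType d') :
    Prop :=
  exists g : F -> P, set_bij [set: F] Q g /\ {mono g : x y / x <= y}.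

Definition pairs (P : Type) : Type := {e : set P | e #= `I_2}.

(* The two colours 0 and 1 are false and true. *)
Definition constant_on (P : Type) (f : pairs P -> bool) (Q : set P)
    (i : bool) : Prop :=
  forall e : pairs P, sval e `<=` Q -> f e = i.

(* T --> (F, n)^2 *)
Definition arrow d d' (T : orderType d) (F : orderType d') (n : nat) : Prop :=
  forall (dP : Order.disp_t) (P : orderType dP), has_type [set: P] T ->
  forall f : pairs P -> bool,
    (exists Q : set P, has_type Q F /\ constant_on f Q false) \/
    (exists Q : set P, Q #= `I_n /\ constant_on f Q true).

(* Main.v *)
(* Call a pair A < B of sets of size < kappa a gap, and say that S is dense in a
   gap when it meets every gap extending it.  By induction on n, every S dense
   in some gap contains either a 0-homogeneous copy of F or a 1-homogeneous set
   of size n.  If for some x in S the set of 1-neighbours of x in S is dense in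
   a further gap, the induction hypothesis applies to it and x can be added to
   the 1-homogeneous set.  Otherwise these sets of neighbours are all nowhere
   dense, and F is embedded in kappa steps: by regularity fewer than kappa
   nowhere dense sets are avoided by one gap extending the current one, and S
   meets that gap in the next point of the copy. *)

Require Import Defs.
From mathcomp Require Import all_boot all_order.
From mathcomp Require Import boolp classical_sets functions cardinality.
From mathcomp Require wochoice.

Set Implicit Arguments.
Unset Strict Implicit.
Unset Printing Implicit Defensive.

Import Order.TTheory.

Local Open Scope classical_set_scope.
Local Open Scope card_scope.
Local Open Scope order_scope.

(** * Cardinality, and choice by recursion along a well-order *)

Lemma card_le_setTP (T U : Type) (B : set U) :
  [set: T] #<= B <-> exists2 u : T -> U, injective u & forall x, B (u x).
Proof.
split=> [/card_leP[f]|[u u_inj uB]]; last first.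
  have /card_eqPle[_ le_T] := inj_card_eq (in2W u_inj : {in [set: T] &, injective u}).
  by apply: card_le_trans le_T _; apply: subset_card_le => _ [x _ <-].
exists (fun x => set_val (f (SigSub (in_setT x)))) => [x y|x]; last first.
  exact: set_valP.
move=> /val_inj fE.
have := @inj _ _ _ f _ _ (in_setT _) (in_setT _) fE.
by move/(congr1 val).
Qed.

Lemma card_eq_setTP (T U : Type) :
  [set: T] #= [set: U] -> exists f : T -> U, bijective f.
Proof.
move=> /card_bijP[f [g fK gK]].
pose inT V (x : V) : [set: V] := SigSub (in_setT x).
have inTK V (x : [set: V]) : inT V (val x) = x by exact: val_inj.
by exists (val \o f \o inT T); exists (val \o g \o inT U) => x /=;
  rewrite inTK ?fK ?gK.
Qed.

Lemma well_order_wf d (K : orderType d) :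
  wochoice.well_order (<=%O : rel K) -> well_founded (fun x y : K => x < y).
Proof.
move=> wo x; apply: contrapT => nAx.
pose A := [pred y : K | `[< ~ Acc (fun x y : K => x < y) y >]].
have [|z [[/asboolP nAz zmin] _]] := wo A; first by exists x; apply/asboolP.
apply: nAz; constructor=> y yz; apply: contrapT => nAy.
by move: yz; rewrite ltNge zmin//; apply/asboolP.
Qed.

(** Dependent choice of transfinite length, the engine of the three recursive constructions below.
    The relation takes a total function, so the first condition on [R] makes it read only the values
    below [i]. *)
Lemma wf_choice d (K : orderType d) (X : Type)
    (R : K -> (K -> X) -> X -> Prop) :
  well_founded (fun x y : K => x < y) -> X ->
  (forall i f g v, (forall j, j < i -> f j = g j) -> R i f v -> R i g v) ->
  (forall i f, (forall j, j < i -> R j f (f j)) -> exists v, R i f v) ->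
  exists f, forall i, R i f (f i).
Proof.
move=> wf x0 R_ext R_ex.
(* Off the segment below [i], the partial function is completed by the junk value [x0]. *)
pose ext i (rec : forall j : K, j < i -> X) j :=
  if pselect (j < i) is left ji then rec j ji else x0.
pose step i (rec : forall j : K, j < i -> X) :=
  if pselect (exists v, R i (ext i rec) v) is left h then projT1 (cid h)
  else x0.
pose f := Fix wf (fun=> X) step.
have fE i : f i = step i (fun j _ => f j).
  apply: (Fix_eq wf (fun=> X) step) => j g h gh; congr (step j _).
  by apply: functional_extensionality_dep => k; apply: functional_extensionality_dep.
have extE i j : j < i -> ext i (fun j _ => f j) j = f j.
  by rewrite /ext; case: pselect.
exists f => i; elim/(well_founded_ind wf): i => i IH.
rewrite fE /step; case: pselect => [h|[]].
  by case: (cid h) => v /= Rv; apply: R_ext Rv => j /extE.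
have [v Rv] := R_ex i f IH; exists v.
by apply: R_ext Rv => j /extE.
Qed.

(** * Sets of size less than a regular cardinal *)

Section RegularCardinal.
Context d (K : orderType d).
Hypothesis K_regular : infinite_regular_cardinal K.

(** A negated form of [card_lt], which passes to smaller sets by transitivity alone; [smallP]
    relates the two. *)
Definition small T (A : set T) := ~ ([set: K] #<= A).

Let K_wf : well_founded (fun x y : K => x < y).
Proof. by case: K_regular => -[/well_order_wf]. Qed.

Lemma small_initial (x : K) : small [set y | y < x].
Proof. by case: K_regular => -[_ /(_ x)[]]. Qed.

Lemma small_le T U (A : set T) (B : set U) : A #<= B -> small B -> small A.
Proof. by move=> AB sB /card_le_trans/(_ AB). Qed.

Lemma small_finite T (A : set T) : finite_set A -> small A.
Proof. by move=> finA /card_le_finite/(_ finA); case: K_regular. Qed.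

Lemma small_bounded (X : set K) : small X -> exists x, forall y, X y -> y < x.
Proof.
move=> sX; apply: contrapT => nb; apply: sX; case: K_regular => _ _; apply.
move=> x; apply: contrapT => nx; apply: nb; exists x => y Xy.
by rewrite ltNge; apply/negP => xy; apply: nx; exists y.
Qed.

(** This is comparability of cardinals. If [A] did not inject into [K], values in [A] could be
    picked injectively along [K]: the earlier ones never exhaust [A], since an image of [K] has size
    at most that of [K]. *)
Lemma smallP T (A : set T) : small A <-> card_lt A [set: K].
Proof.
split=> [sA|[]//]; split=> //.
have [[x0 _]|/set0P/negP] := pselect (A !=set0); last first.
  by rewrite negbK => /eqP->; exact: card_ge0.
apply: contrapT => nAK; apply: sA; apply/card_le_setTP.
pose R i (f : K -> T) v := A v /\ forall j, j < i -> f j <> v.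
have [||f fP] := @wf_choice _ K T R K_wf x0.
- by move=> i f g v fg [Av nv]; split=> // j ji; rewrite -fg//; exact: nv.
- move=> i f _; apply: contrapT => nv; apply: nAK.
  apply: (@card_le_trans _ _ _ (f @` [set: K])); last exact: card_image_le.
  apply: subset_card_le => v Av; apply: contrapT => nfv; apply: nv; exists v.
  by split=> // j _ fjv; apply: nfv; exists j.
exists f => [i j fij|i]; last by case: (fP i).
case: (ltgtP i j) => // ij.
  by case: (fP j) => _ /(_ i ij).
by case: (fP i) => _ /(_ j ij); rewrite fij.
Qed.

(* A copy of K in the union would split K into few small, hence bounded, pieces,
   and their bounds would themselves be bounded. *)
Lemma small_bigcup I T (D : set I) (A : I -> set T) :
  small D -> (forall i, D i -> small (A i)) -> small (\bigcup_(i in D) A i).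
Proof.
move=> sD sA /card_le_setTP[u u_inj uA].
have [x0 _] := small_bounded (small_finite (finite_set0 K)).
have bd i : exists x, D i -> forall y, A i (u y) -> y < x.
  have [Di|nDi] := pselect (D i); last by exists x0.
  suff /small_bounded[x xP] : small [set y | A i (u y)] by exists x => _ y /xP.
  apply: small_le (sA i Di).
  have /card_eqPle[_ le_u] :=
    inj_card_eq (in2W u_inj : {in [set y | A i (u y)] &, injective u}).
  by apply: card_le_trans le_u _; apply: subset_card_le => _ [y ? <-].
have [x xP] := choice bd.
have /small_bounded[z zP] : small (x @` D).
  by apply: small_le sD; exact: card_image_le.
have [i Di Ai] := uA z.
have := lt_trans (xP i Di z Ai) (zP (x i) (imageP _ Di)).
by rewrite ltxx.
Qed.

Lemma smallU T (A B : set T) : small A -> small B -> small (A `|` B).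
Proof.
move=> sA sB.
apply: (@small_le _ _ _ (\bigcup_(b in [set: bool]) if b then A else B)).
  by apply: subset_card_le => x [?|?]; [exists true|exists false].
by apply: small_bigcup => [|[]//]; apply: small_finite; exact: finite_finset.
Qed.

(** * Gaps, dense and nowhere dense sets *)

Section Gaps.
Context dP (P : orderType dP).
Implicit Types (S : set P) (p q : set P * set P).

Definition gap p := [/\ small p.1, small p.2 & set_lt p.1 p.2].

Definition gap_le p q := p.1 `<=` q.1 /\ p.2 `<=` q.2.

Definition fills p (c : P) := set_lt p.1 [set c] /\ set_lt [set c] p.2.

Definition dense_in p S := forall q, gap q -> gap_le p q -> exists2 c, S c & fills q c.

Definition nowhere_dense_in p S := forall q, gap q -> gap_le p q -> ~ dense_in q S.

Lemma gap_le_refl p : gap_le p p.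
Proof. by split. Qed.

Lemma gap_le_trans p q r : gap_le p q -> gap_le q r -> gap_le p r.
Proof. by move=> [? ?] [? ?]; split; apply: subset_trans; eassumption. Qed.

Lemma gap_le_fills p q c : gap_le p q -> fills q c -> fills p c.
Proof.
by move=> [pq1 pq2] [q1c cq2]; split=> [a b /pq1|a b ac /pq2]; [exact: q1c|exact: cq2].
Qed.

(** A Baire category argument: an increasing chain of gaps is built whose [k]-th member is filled by
    no point of [S k]. Unions along the chain are still gaps because fewer than kappa small sets
    have a small union. *)
Lemma avoid_nowhere_dense p (S : K -> set P) (i : K) : gap p ->
  (forall j, j < i -> nowhere_dense_in p (S j)) ->
  exists q, [/\ gap q, gap_le p q &
    forall j c, j < i -> S j c -> ~ fills q c].
Proof.
move=> gp nd.
(* The union of [p] and all earlier gaps treats successor and limit stages alike. *)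
pose U k (f : K -> set P * set P) : set P * set P :=
  (p.1 `|` \bigcup_(j in [set j | j < k]) (f j).1,
   p.2 `|` \bigcup_(j in [set j | j < k]) (f j).2).
have pU k f : gap_le p (U k f) by split=> ? ?; left.
have fU k f j : j < k -> gap_le (f j) (U k f).
  by move=> jk; split=> ? ?; right; exists j.
(* The recursion runs over all of [K]; from [i] on there is nothing to avoid, and the union itself
   is taken. *)
pose R k f q := [/\ gap q, gap_le (U k f) q &
  k < i -> forall c, S k c -> ~ fills q c].
have gapU k f : (forall j, j < k -> R j f (f j)) -> gap (U k f).
  move=> fR; case: (gp) => sp1 sp2 ltp.
  split.
  - apply: smallU => //; apply: small_bigcup => [|j /fR[[]]//].
    exact: small_initial.
  - apply: smallU => //; apply: small_bigcup => [|j /fR[[]]//].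
    exact: small_initial.
  have pf j : j < k -> gap_le p (f j).
    by move=> /fR[_ Uf _]; apply: gap_le_trans Uf.
  move=> a b [pa|[j jk fa]] [pb|[l lk fb]].
  - exact: ltp.
  - by have [[_ _ +] _ _] := fR l lk; apply => //; apply: (pf l lk).1.
  - by have [[_ _ +] _ _] := fR j jk; apply => //; apply: (pf j jk).2.
  (* Points from two stages are compared in the later gap, which contains the earlier one. *)
  have [lj|jl] := leP l j.
    have [[_ _ +] _ _] := fR j jk; apply => //.
    move: lj; rewrite le_eqVlt => /predU1P[<-//|lj].
    by have [_ Uf _] := fR j jk; apply: (gap_le_trans (fU j f l lj) Uf).2.
  have [[_ _ +] _ _] := fR l lk; apply => //.
  by have [_ Uf _] := fR l lk; apply: (gap_le_trans (fU l f j jl) Uf).1.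
have [||f fR] := @wf_choice _ K _ R K_wf p.
- move=> k f g q fg [? Uq ?]; split=> //; suff <- : U k f = U k g by [].
  by congr (_ `|` _, _ `|` _); apply: eq_bigcupr => j /fg->.
- move=> k f fR; have gU := gapU k f fR.
  have [ki|nki] := pselect (k < i); last first.
    by exists (U k f); split=> //; exact: gap_le_refl.
  have /existsNP[q /not_implyP[gq /not_implyP[Uq nq]]] := nd k ki _ gU (pU k f).
  by exists q; split=> // _ c Sc qc; apply: nq; exists c.
exists (U i f); split=> //; first exact: gapU.
move=> j c ji Sc /(gap_le_fills (fU i f j ji)).
by have [_ _] := fR j; apply.
Qed.

(** * Embedding [F], and the induction on [n] *)

Section Colouring.
Context dF (F : orderType dF) (e : K -> F) (h : F -> K).
Hypothesis hK : cancel h e.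
Variable col : P -> P -> Prop.
Hypotheses (col_irr : forall x, ~ col x x)
  (col_sym : forall x y, col x y -> col y x).

(** [F] is enumerated along [K] by [e]. The point chosen at stage [i] lies in the cut that [e i]
    makes among the earlier points, and outside all their neighbour sets. *)
Lemma free_copy p S : gap p -> dense_in p S ->
  (forall x, S x -> nowhere_dense_in p [set y | S y /\ col x y]) ->
  exists g : F -> P, [/\ forall x, S (g x), {mono g : x y / x <= y} &
    forall x y, h x < h y -> ~ col (g x) (g y)].
Proof.
move=> gp dS nd.
pose R i (f : K -> P) c := [/\ S c, fills p c & forall j, j < i ->
  [/\ e j < e i -> f j < c, e i < e j -> c < f j & ~ col (f j) c]].
have [x0 _ _] := dS p gp (gap_le_refl p).
have [||f fR] := @wf_choice _ K _ R K_wf x0.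
- move=> i f f' c ff' [Sc pc fc]; split=> // j ji; rewrite -ff'//; exact: fc.
- move=> i f fR.
  pose q : set P * set P := (p.1 `|` f @` [set j | j < i /\ e j < e i],
                 p.2 `|` f @` [set j | j < i /\ e i < e j]).
  have small_f (D : set K) : small (f @` [set j | j < i /\ D j]).
    apply: (@small_le _ _ _ [set j | j < i]); last exact: small_initial.
    apply: card_le_trans (card_image_le _ _) _.
    by apply: subset_card_le => j [].
  have gq : gap q.
    case: gp => sp1 sp2 ltp; split; [exact: smallU|exact: smallU|].
    move=> a b [pa|[j [ji ej] <-]] [pb|[l [li el] <-]].
    + exact: ltp.
    + by have [_ [+ _] _] := fR l li; apply.
    + by have [_ [_ +] _] := fR j ji; apply.
    (* Both points were chosen earlier, so the order clause recorded at the later of the two stages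
       compares them. *)
    have ejl := lt_trans ej el.
    have [jl|lj|jl] := ltgtP j l; last by rewrite jl ltxx in ejl.
      by have [_ _ /(_ j jl)[+ _ _]] := fR l li; apply.
    by have [_ _ /(_ l lj)[_ + _]] := fR j ji; apply.
  have pq : gap_le p q by split=> ? ?; left.
  (* Neighbour sets of earlier points are nowhere dense in [p], hence in [q]; a point of [S] filling
     [r] avoids them all. *)
  have [|r [gr qr rP]] := @avoid_nowhere_dense q (fun j => [set y | S y /\ col (f j) y]) i gq.
    move=> j ji s gs qs; have [Sj _ _] := fR j ji.
    by apply: nd => //; apply: gap_le_trans qs.
  have [c Sc rc] := dS r gr (gap_le_trans pq qr).
  have [qc cq] := gap_le_fills qr rc.
  exists c; split=> //; first exact: (gap_le_fills (gap_le_trans pq qr)).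
  move=> j ji; split=> [ej|ej|cj].
  + by apply: qc => //; right; exists j.
  + by apply: cq => //; right; exists j.
  by apply: (rP j c ji) rc.
exists (f \o h); split.
- by move=> x; have [] := fR (h x).
- apply: le_mono => x y xy; have [hxy|hyx|/(can_inj hK) exy] := ltgtP (h x) (h y).
  + by have [_ _ /(_ _ hxy)[+ _ _]] := fR (h y); rewrite !hK; apply.
  + by have [_ _ /(_ _ hyx)[_ + _]] := fR (h x); rewrite !hK; apply.
  by rewrite exy ltxx in xy.
- by move=> x y hxy; have [_ _ /(_ _ hxy)[]] := fR (h y).
Qed.

(** The induction keeps [p] and [S] general because the neighbours of [x] are dense only in a
    further gap. Demanding [Q] inside [S] is what lets [x] be added. *)
Lemma dense_arrow n p S : gap p -> dense_in p S ->
  (exists g : F -> P, [/\ forall x, S (g x), {mono g : x y / x <= y} &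
    forall x y, h x < h y -> ~ col (g x) (g y)]) \/
  (exists Q, [/\ Q `<=` S, Q #= `I_n &
    forall x y, Q x -> Q y -> x <> y -> col x y]).
Proof.
elim: n p S => [|n IH] p S gp dS.
  by right; exists set0; split=> //; rewrite II0.
have [nd|] := pselect (forall x, S x -> nowhere_dense_in p [set y | S y /\ col x y]).
  by left; exact: free_copy dS nd.
move=> /existsNP[x /not_implyP[Sx]].
move=> /existsNP[q /not_implyP[gq /not_implyP[pq /contrapT dx]]].
have [[g [gS gm gc]]|[Q [QS Qn Qc]]] := IH q _ gq dx.
  by left; exists g; split=> // y; case: (gS y).
have nQx : ~ Q x by move=> /QS[_ /col_irr].
right; exists (Q `|` [set x]); split.
- by move=> y [/QS[]|->].
- apply/eq_cardSP; exists x; first by right.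
  by rewrite setUDK// => y /= [-> Qy].
move=> y z [Qy|->] [Qz|->] yz //.
- exact: Qc.
- by apply: col_sym; case: (QS y Qy).
- by case: (QS z Qz).
Qed.

End Colouring.
End Gaps.
End RegularCardinal.

(** * From colourings of pairs to symmetric relations *)

Section PairColouring.
Context dP (P : orderType dP) (f : pairs P -> bool).

(** Quantifying over [pairs P] makes the relation irreflexive for either colour, as a singleton is
    not a pair. *)
Definition coloured (i : bool) (x y : P) :=
  exists e : pairs P, sval e = [set x; y] /\ f e = i.

Lemma pairsP (e : pairs P) : exists x y, x <> y /\ sval e = [set x; y].
Proof.
case: e => E /= /eq_cardSP[x Ex /eq_cardSP[y [Ey yx]]].
rewrite II0 card_eq0 => /eqP E0; exists x, y; split; first by move=> xy; exact: yx.
apply/seteqP; split=> [z Ez|z [->|->]//].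
have [->|zx] := pselect (z = x); first by left.
have [->|zy] := pselect (z = y); first by right.
by have : (E `\ x `\ y) z by []; rewrite E0.
Qed.

Lemma coloured_sym i x y : coloured i x y -> coloured i y x.
Proof. by move=> [e [exy fe]]; exists e; rewrite setUC. Qed.

Lemma coloured_irr i x : ~ coloured i x x.
Proof.
move=> [e [exx _]]; have [y [z [yz]]] := pairsP e; rewrite exx setUid => xE.
apply: yz; have [/= <- <-//] : [set x] y /\ [set x] z.
by rewrite xE; split; [left|right].
Qed.

Lemma constant_onP (Q : set P) i :
  (forall x y, Q x -> Q y -> x <> y -> ~ coloured (~~ i) x y) ->
  constant_on f Q i.
Proof.
move=> Qf e eQ; have [x [y [xy exy]]] := pairsP e.
have Qx : Q x by apply: eQ; rewrite exy; left.
have Qy : Q y by apply: eQ; rewrite exy; right.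
case: (eqVneq (f e) i) => // fi; case: (Qf x y Qx Qy xy); exists e; split=> //.
by move: fi; case: (f e); case: (i).
Qed.

Lemma coloured_fun i j x y : coloured i x y -> coloured j x y -> i = j.
Proof.
move=> [[E Ep] [/= Exy <-]] [[E' E'p] [/= E'xy <-]].
have EE : E = E' by rewrite Exy.
by congr (f _); apply: eq_exist.
Qed.

End PairColouring.

(** * The partition relation *)

Theorem theorem2p9
  (dK : Order.disp_t) (K : orderType dK)
  (K_regular : infinite_regular_cardinal K)
  (dF : Order.disp_t) (F : orderType dF)
  (F_size : [set: F] #= [set: K])
  (n : nat)
  (dT : Order.disp_t) (T : orderType dT)
  (T_saturated : saturated K T) :
  arrow T F n.
Proof.
move=> dP P [t [[_ t_inj t_surj] t_mono]] f.
have [h [e hK _]] := card_eq_setTP F_size.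
have small0 (U : Type) : small K (@set0 U).
  by apply: small_finite => //; exact: finite_set0.
have g0 : gap K (@set0 P, @set0 P) by split.
(* Density of the whole order in the empty gap is saturation, transported from [T] to [P] by pulling
   gaps back along [t]. *)
have dP0 : dense_in K (@set0 P, @set0 P) [set: P].
  move=> [A B] [sA sB AB] _.
  have sT (C : set P) : small K C -> card_lt (t @^-1` C) [set: K].
    move=> sC; apply/smallP => //; apply: small_le sC.
    have /card_eqPle[_ le_t] := inj_card_eq (sub_in2 (fun _ _ => mem_setT _) t_inj : {in t @^-1` C &, injective t}).
    by apply: card_le_trans le_t _; apply: subset_card_le => _ [x ? <-].
  have tlt x y : (t x < t y) = (x < y) by rewrite !ltNge t_mono.
  have [|c [Ac cB]] := T_saturated.2 _ _ (sT A sA) (sT B sB).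
    by move=> x y Ax By; rewrite -tlt; exact: AB.
  exists (t c) => //; split=> [x _ Ax ->|_ x -> Bx].
    have [y _ xE] := t_surj x I; move: Ax; rewrite -xE tlt => Ay.
    exact: Ac.
  have [y _ xE] := t_surj x I; move: Bx; rewrite -xE tlt => By.
  exact: cB.
have := @dense_arrow _ K K_regular _ P _ F e h hK (coloured f true)
  (@coloured_irr _ _ f true) (@coloured_sym _ _ f true) n _ _ g0 dP0.
move=> [[g [_ g_mono g_col]]|[Q [_ Qn Qcol]]]; [left|right].
  exists (range g); split.
    exists g; split=> //; split=> [x _|x y _ _ gxy|x [y _ <-]]; [by exists x| |by exists y].
    by apply: le_anti; rewrite -!g_mono gxy lexx.
  apply: constant_onP => _ _ [x _ <-] [y _ <-] gxy.
  (* [g_col] speaks only of pairs in the order of enumeration; symmetry gives the others. *)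
  have [hxy|hyx|hxy] := ltgtP (h x) (h y).
  - exact: g_col.
  - by move/coloured_sym; exact: g_col.
  - by case: gxy; rewrite (can_inj hK hxy).
exists Q; split=> //; apply: constant_onP => x y Qx Qy xy.
by move/(coloured_fun (Qcol x y Qx Qy xy)).
Qed.
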